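(* There exist finite semigroup presentations (equipped with an admissible ordering) for which the G-completion and the R-completion do not agree. More precisely, writing $\widehat{\mathcal R}{}^G$ for the G-completion and $\widehat{\mathcal R}{}^R$ for the R-completion of a presentation $(\mathcal S;\mathcal R)$, for each of the following behaviours there exists a finite semigroup presentation $(\mathcal S;\mathcal R)$ exhibiting it: (type 1) $\widehat{\mathcal R}{}^R$ is a proper subset of $\widehat{\mathcal R}{}^G$, with $\widehat{\mathcal R}{}^R$ finite and $\widehat{\mathcal R}{}^G$ infinite; (type 1') $\widehat{\mathcal R}{}^R$ is a proper subset of $\widehat{\mathcal R}{}^G$, with both $\widehat{\mathcal R}{}^R$ and $\widehat{\mathcal R}{}^G$ finite; (type 2) $\widehat{\mathcal R}{}^G$ is a proper subset of $\widehat{\mathcal R}{}^R$, with $\widehat{\mathcal R}{}^G$ finite and $\widehat{\mathcal R}{}^R$ infinite; (type 3) $\widehat{\mathcal R}{}^G$ and $\widehat{\mathcal R}{}^R$ are not comparable with respect to inclusion.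
   Context: Presentations. For a nonempty set $\mathcal S$, $\mathcal S^*$ is the free monoid of words on $\mathcal S$, $\varepsilon$ is the empty word, and $\mathcal S^+=\mathcal S^*\setminus\{\varepsilon\}$. A semigroup presentation $(\mathcal S;\mathcal R)$ consists of a nonempty set $\mathcal S$ (generators) and a set $\mathcal R$ of pairs $(u,v)$ of nonempty words on $\mathcal S$ (relations), also written $u=v$; it is finite if $\mathcal S$ and $\mathcal R$ are finite. $\equiv$ is the smallest congruence on $\mathcal S^*$ containing $\mathcal R$. When sets of relations are compared by inclusion, relations are regarded up to orientation ($u=v$ and $v=u$ are identified). G-completion. An admissible ordering on $\mathcal S^*$ is a (linear) well-ordering $<$ such that $f<g$ implies $ufv<ugv$ for all words $u,v$; for example the deglex (homogeneous lexicographic) ordering associated with a linear ordering of the finite set $\mathcal S$: words are compared first by length, then lexicographically. Fix an admissible ordering. A Gröbner basis of $(\mathcal S;\mathcal R)$ is a set $\mathcal B$ of pairs $(u,v)$ with $u\equiv v$ and $u>v$ such that for all words $w\equiv w'$ with $w>w'$ there is $(u,v)\in\mathcal B$ such that $u$ is a subword (factor) of $w$. It is reduced if no relation of it can be reduced by the others, i.e. for every $(u,v)\in\mathcal B$, $v$ contains as a factor no $u'$ with $(u',v')\in\mathcal B$, and $u$ contains as a factor no $u'$ with $(u',v')\in\mathcal B\setminus\{(u,v)\}$. The G-completion $\widehat{\mathcal R}{}^G$ is the reduced Gröbner basis of $(\mathcal S;\mathcal R)$ for the chosen ordering. R-completion. Let $\mathcal S^{-1}=\{s^{-1}: s\in\mathcal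 S\}$ be a disjoint copy of $\mathcal S$; for $u=s_1\cdots s_n\in\mathcal S^*$ put $u^{-1}=s_n^{-1}\cdots s_1^{-1}$. For a set of relations $\mathcal Q$ and words $w,w'$ on $\mathcal S\cup\mathcal S^{-1}$, $w$ reverses in one step to $w'$ (with respect to $\mathcal Q$) if $w'$ is obtained from $w$ either by deleting a subword $u^{-1}u$ with $u\in\mathcal S^+$, or by replacing a subword $u^{-1}v$ ($u,v$ nonempty words on $\mathcal S$) with $v'u'^{-1}$, where $uv'=vu'$ is a relation of $\mathcal Q$ (read in either orientation, with $u',v'\in\mathcal S^*$). Write $w\curvearrowright w'$ if $w'$ is obtained from $w$ by finitely many such steps. The R-completion $\widehat{\mathcal R}{}^R$ is the set of relations produced by the following (possibly infinite) procedure: put $\mathcal R_0=\mathcal R$; given $\mathcal R_i$, for every triple of (not necessarily distinct) letters $s,r,t\in\mathcal S$ and every word $uv^{-1}$ with $u,v\in\mathcal S^*$ such that $s^{-1}rr^{-1}t\curvearrowright uv^{-1}$ with respect to $\mathcal R_i$, add the relation $su=tv$ if $(su)^{-1}(tv)\curvearrowright\varepsilon$ fails with respect to $\mathcal R_i$; let $\mathcal R_{i+1}$ be the resulting set. Then $\widehat{\mathcal R}{}^R=\bigcup_i\mathcal R_i$. *)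

(* Defs.v *)
From mathcomp Require Import all_boot.
From mathcomp Require Import boolp classical_sets cardinality.
From Stdlib Require Import Relation_Operators.

Set Implicit Arguments.
Unset Strict Implicit.
Unset Printing Implicit Defensive.

Local Open Scope classical_set_scope.

Notation word S := (seq S).
Notation relations S := (set (word S * word S)).

Definition semigroup_presentation (S : Type) (R : relations S) : Prop :=
  inhabited S /\ forall u v, R (u, v) -> u <> [::] /\ v <> [::].

Inductive congruence (S : Type) (R : relations S) : word S -> word S -> Prop :=
| congr_rel u v : R (u, v) -> congruence R u v
| congr_refl u : congruence R u u
| congr_sym u v : congruence R u v -> congruence R v u
| congr_trans u v w : congruence R u v -> congruence R v w -> congruence R u w
| congr_ctx x y u v : congruence R u v -> congruence R (x ++ u ++ y) (x ++ v ++ y).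

(* Relations up to orientation: Q and Q' are identified when their symmetric
   closures coincide, and compared by comparing these closures. *)
Definition unoriented (S : Type) (Q : relations S) : relations S :=
  [set p | Q (p.1, p.2) \/ Q (p.2, p.1)].

Section GCompletion.
Variable S : eqType.
Implicit Types (lt : rel (word S)) (R B : relations S).

Definition admissible_ordering lt : Prop :=
  [/\ irreflexive lt, transitive lt,
      forall f g, f != g -> lt f g || lt g f,
      well_founded lt
    & forall f g u v, lt f g -> lt (u ++ f ++ v) (u ++ g ++ v)].

Definition groebner_basis lt R B : Prop :=
  (forall u v, B (u, v) -> congruence R u v /\ lt v u) /\
  (forall w w', congruence R w w' -> lt w' w ->
     exists u v, B (u, v) /\ infix u w).

Definition reduced B : Prop :=
  forall u v u' v', B (u, v) -> B (u', v') ->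
    ~~ infix u' v /\ ((u', v') <> (u, v) -> ~~ infix u' u).

(* For an admissible lt, at most one B satisfies this predicate: it consists of
   the pairs (u, v) with u a factor-minimal word that is not lt-least in its
   class, and v the lt-least word of that class. *)
Definition is_G_completion lt R B : Prop := groebner_basis lt R B /\ reduced B.

End GCompletion.

Section RCompletion.
Variable S : Type.
Implicit Types (Q R : relations S).

(* Signed words: inl s is the letter s and inr s its formal inverse. *)
Definition pos (u : word S) : word (S + S) := map inl u.
Definition inv (u : word S) : word (S + S) := map inr (rev u).

Inductive reverses_step Q : word (S + S) -> word (S + S) -> Prop :=
| reverses_delete x y u :
    u <> [::] -> reverses_step Q (x ++ inv u ++ pos u ++ y) (x ++ y)
| reverses_replace x y u v u' v' :
    u <> [::] -> v <> [::] -> unoriented Q (u ++ v', v ++ u') ->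
    reverses_step Q (x ++ inv u ++ pos v ++ y) (x ++ pos v' ++ inv u' ++ y).

Definition reverses Q : word (S + S) -> word (S + S) -> Prop :=
  clos_refl_trans _ (reverses_step Q).

Definition R_completion_step Q : relations S :=
  Q `|` [set p | exists s r t u v,
    [/\ reverses Q (inv [:: s] ++ pos [:: r] ++ inv [:: r] ++ pos [:: t])
                   (pos u ++ inv v),
        ~ reverses Q (inv (s :: u) ++ pos (t :: v)) [::]
      & p = (s :: u, t :: v)]].

Definition R_completion R : relations S :=
  \bigcup_i iter i R_completion_step R.

End RCompletion.

Definition finite_presentation_with_G_completion (S : finType)
    (lt : rel (word S)) (R G : relations S) : Prop :=
  [/\ semigroup_presentation R, finite_set R,
      admissible_ordering lt & is_G_completion lt R G].

(* Main.v *)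
Require Import Defs.
From mathcomp Require Import all_boot zify.
From mathcomp Require Import boolp classical_sets cardinality.
From Stdlib Require Import Relation_Operators Operators_Properties Wf_nat.

Set Implicit Arguments.
Unset Strict Implicit.
Unset Printing Implicit Defensive.

Local Open Scope classical_set_scope.

Local Notation inv := Defs.inv.

(* Reversing is sound, so if u^-1 v reverses to the empty word whenever u = v
   in the monoid, then the R-completion adds nothing. This happens for
   - (a, b; aa = ba) with b < a, where the G-completion consists of all
     a b^n a = b^(n+1) a (type 1);
   - the same presentation with the redundant relation aaa = baa, which aa = ba
     reduces, so that it is missing from the unchanged G-completion (type 3);
   - (a, b; aa = b) with a < b, where the G-completion adds ba = ab (type 1').
   For type 2, take ac = ca, bc = cb, bd = ad with c < a < b. This is its own
   G-completion, having no overlaps, but a and b have the infinitely many minimal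
   common multiples a c^n d = b c^n d. From such a relation the cube a^-1 c c^-1 b
   leads to the next one, which reversing cannot derive from the others. *)

(** * The deglex ordering *)

Section Deglex.
Variables (S : eqType) (k : nat) (d : S -> nat).

(* With n = 1 this is the base k number whose digits are 1 followed by the
   letters of w: comparing such numbers is comparing words in deglex order. *)
Definition digits n (w : word S) := foldl (fun m s => m * k + d s) n w.
Definition deglex : rel (word S) := fun u v => digits 1 u < digits 1 v.

Hypotheses (k_gt1 : 1 < k) (d_lt : forall s, d s < k) (d_inj : injective d).

Lemma digitsE n w : digits n w = n * k ^ size w + digits 0 w.
Proof.
elim: w n => [|s w IH] n /=; first by rewrite muln1 addn0.
rewrite /digits /= -!/(digits _ _) IH [digits (0 * k + d s) w]IH expnS.
by rewrite mul0n add0n mulnDl mulnA addnA.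
Qed.

Lemma digits_lt w : digits 0 w < k ^ size w.
Proof.
elim/last_ind: w => [|w s IH] //.
rewrite size_rcons expnSr /digits foldl_rcons -/(digits _ _).
by have := d_lt s; nia.
Qed.

(** A positive leading part makes length decisive: [digits n u] < (n+1) k^|u| <= n k^(|u|+1), since
    n >= 1 and k >= 2. *)
Lemma digits_size n u v : 0 < n -> size u < size v -> digits n u < digits n v.
Proof.
move=> n_gt0 uv; rewrite digitsE [digits n v]digitsE.
have le_pow : k ^ size u * k <= k ^ size v by rewrite -expnSr leq_exp2l.
have := digits_lt u; nia.
Qed.

Lemma digits_inj : injective (digits 1).
Proof.
move=> u v.
wlog le_uv : u v / size u <= size v.
  by move=> H; case: (leqP (size u) (size v)) => [/H//|/ltnW/H I /esym/I].
move=> E; have Esz : size u = size v.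
  apply/eqP; rewrite eqn_leq le_uv leqNgt; apply/negP => /(@digits_size 1).
  by rewrite E ltnn => /(_ isT).
elim/last_ind: u v Esz E {le_uv} => [|u s IH] v; first by case: v.
case/lastP: v => [|v t]; rewrite !size_rcons // => -[Esz].
rewrite /digits !foldl_rcons -!/(digits _ _) => E.
have [Hs Ht] := (d_lt s, d_lt t).
(* The last letter is the residue modulo k. *)
have Ed : d s = d t.
  by have := congr1 (modn^~ k) E; rewrite /= !modnMDl !modn_small.
move: E; rewrite Ed => /addIn /eqP; rewrite eqn_pmul2r; last by lia.
by move=> /eqP /IH -> //; rewrite (d_inj Ed).
Qed.

Lemma deglex_admissible : admissible_ordering deglex.
Proof.
split.
- by move=> u; rewrite /deglex ltnn.
- by move=> v u w; apply: ltn_trans.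
- move=> u v neq_uv; rewrite /deglex -neq_ltn.
  by apply: contra neq_uv => /eqP /digits_inj ->.
- apply: (well_founded_lt_compat _ (digits 1)) => u v; rewrite /deglex; lia.
(* The suffix v scales both numbers by k^|v| and adds the same amount when f and g precede it; the
   prefix u only changes the leading part 1 into another positive number. *)
- move=> f g u v fg; rewrite /deglex /digits !foldl_cat -!/(digits _ _).
  rewrite digitsE [ltnRHS]digitsE ltn_add2r ltn_pmul2r ?expn_gt0; last by lia.
  have c_gt0 : 0 < digits 1 u by rewrite digitsE mul1n addn_gt0 expn_gt0; lia.
  have := fg; rewrite /deglex.
  case: (ltngtP (size f) (size g)) => [lt_sz _|lt_sz|Esz].
  + exact: digits_size.
  + by have := digits_size (ltn0Sn 0) lt_sz; lia.
  + rewrite (digitsE 1 f) (digitsE 1 g) !(digitsE (digits 1 u)).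
    by rewrite Esz !ltn_add2l.
Qed.

End Deglex.

(** * Congruences and normal forms *)

Section Congruence.
Variable S : Type.
Implicit Types (R Q : relations S) (u v w x y : word S).

Lemma congr_catl R x u v : congruence R u v -> congruence R (x ++ u) (x ++ v).
Proof. by move=> /(congr_ctx x [::]); rewrite !cats0. Qed.

Lemma congr_catr R y u v : congruence R u v -> congruence R (u ++ y) (v ++ y).
Proof. exact: (congr_ctx [::] y). Qed.

Lemma congr_cons R s u v : congruence R u v -> congruence R (s :: u) (s :: v).
Proof. exact: (congr_catl [:: s]). Qed.

(** Letters acting on T so that the relations hold define an action of the presented monoid. Normal
    forms and invariants below rest on this. *)
Lemma congruence_foldr R T (f : S -> T -> T) u v :
    (forall u v z, R (u, v) -> foldr f z u = foldr f z v) ->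
  congruence R u v -> forall z, foldr f z u = foldr f z v.
Proof.
move=> Rf; elim=> {u v} //.
- by move=> u v /Rf + z => ->.
- by move=> u v w _ IH1 _ IH2 z; rewrite IH1.
- by move=> x y u v _ IH z; rewrite !foldr_cat IH.
Qed.

End Congruence.

(* Letters act on words through [act], and [foldr act [::]] is a normal form
   which is constant on congruence classes and fixes irreducible words. *)
Lemma groebner_of_action (S : eqType) (lt : rel (word S)) (R B : relations S)
    (act : S -> word S -> word S) :
    admissible_ordering lt ->
    (forall u v, B (u, v) -> congruence R u v /\ lt v u) ->
    (forall u v z, R (u, v) -> foldr act z u = foldr act z v) ->
    (forall s w, act s w = s :: w \/
       lt (act s w) (s :: w) /\ exists u v, B (u, v) /\ prefix u (s :: w)) ->
  groebner_basis lt R B.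
Proof.
move=> [irr trans _ _ ctx] BR Ract actP; split=> // w w' Rw lt_w; apply: contrapT.
move=> Birr; have nf_w : foldr act [::] w = w.
  elim: w Birr {Rw lt_w} => // s w IH Birr.
  rewrite /= IH => [|[u [v [Buv uw]]]]; last first.
    by apply: Birr; exists u, v; split=> //; exact: infix_trans uw (infix_cons _ _).
  case: (actP s w) => // -[_ [u [v [Buv uw]]]]; case: Birr.
  by exists u, v; split=> //; apply: prefixW.
have nf_le x : foldr act [::] x = x \/ lt (foldr act [::] x) x.
  elim: x => [|s x IH]; [by left | rewrite /=].
  have lt_s : foldr act [::] x = x \/ lt (s :: foldr act [::] x) (s :: x).
    case: IH => [|/(ctx _ _ [:: s] [::])]; [by left|].
    by rewrite !cats0; right.
  case: (actP s (foldr act [::] x)) => [->|[lt_act _]].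
    by case: lt_s => [->|]; [left | right].
  by right; case: lt_s => [{2}<-//|]; apply: trans.
(* With nf for the normal form, w = nf w = nf w' <= w' < w. *)
have := congruence_foldr Ract Rw [::]; rewrite nf_w => Ew.
have := nf_le w'; rewrite -Ew => -[E|/(fun h => trans _ _ _ h lt_w)].
  by move: lt_w; rewrite -E irr.
by rewrite irr.
Qed.

(** * Soundness of reversing *)

Section Reversing.
Variable S : Type.
Implicit Types (R Q : relations S) (u v w : word S) (W : word (S + S)).

Lemma inv_cat u v : inv (u ++ v) = inv v ++ inv u.
Proof. by rewrite /inv rev_cat map_cat. Qed.

Lemma inv_cons s u : inv (s :: u) = inv u ++ inv [:: s].
Proof. exact: (inv_cat [:: s]). Qed.

Lemma reverses_ctx Q x y W W' :
  reverses Q W W' -> reverses Q (x ++ W ++ y) (x ++ W' ++ y).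
Proof.
elim=> {W W'} [_ _ [x' y' u un0|x' y' u v u' v' un0 vn0 Quv]|W|W1 W2 W3 _ IH1 _].
- rewrite -!catA 2![x ++ x' ++ _]catA; apply: rt_step.
  exact: reverses_delete.
- rewrite -!catA 2![x ++ x' ++ _]catA; apply: rt_step.
  exact: reverses_replace.
- exact: rt_refl.
- by apply: rt_trans.
Qed.

Lemma reverses_delete_head Q s u v :
  reverses Q (inv (s :: u) ++ pos (s :: v)) (inv u ++ pos v).
Proof.
rewrite inv_cons -catA; apply: rt_step.
exact: (@reverses_delete _ Q (inv u) (pos v) [:: s]).
Qed.

Lemma reverses_replace_head Q s t p q u v : unoriented Q (s :: p, t :: q) ->
  reverses Q (inv (s :: u) ++ pos (t :: v)) (inv u ++ pos p ++ inv q ++ pos v).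
Proof.
move=> Qst; rewrite inv_cons -catA; apply: rt_step.
exact: (@reverses_replace _ Q (inv u) (pos v) [:: s] [:: t]).
Qed.

(* [chain R W m m'] holds when each letter of W can be read as a step between
   elements of the monoid, starting at m and ending at m': s leads from s * k
   to k, and its inverse from k to s * k. For W = u^-1 v this says that
   u m = v m'. Chains can be pulled back along reversing. *)
Fixpoint chain R W (m m' : word S) : Prop :=
  match W with
  | [::] => congruence R m m'
  | inl s :: W => exists2 k, congruence R m (s :: k) & chain R W k m'
  | inr s :: W => chain R W (s :: m) m'
  end.

Lemma chain_congr R W m n m' : congruence R m n -> chain R W m m' -> chain R W n m'.
Proof.
elim: W m n => [|[s|s] W IH] m n Rmn /=.
- by apply: congr_trans; apply: congr_sym.
- by case=> k Rm ?; exists k => //; apply: congr_trans Rm; apply: congr_sym.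
- by apply: IH; apply: congr_cons.
Qed.

Lemma chain_cat R W1 W2 m m' :
  chain R (W1 ++ W2) m m' <-> exists2 k, chain R W1 m k & chain R W2 k m'.
Proof.
elim: W1 m => [|[s|s] W1 IH] m /=; last exact: IH.
- split=> [?|[k Rmk]]; first by exists m => //; apply: congr_refl.
  by apply: chain_congr; apply: congr_sym.
- split=> [[k Rm /IH[n ? ?]]|[n [k Rm ?] ?]]; first by exists n => //; exists k.
  by exists k => //; apply/IH; exists n.
Qed.

Lemma chain_pos R u m m' : chain R (pos u) m m' <-> congruence R m (u ++ m').
Proof.
elim: u m => [|s u IH] m //=; split=> [[k Rm /IH Rk]|Rm].
  by apply: congr_trans Rm _; apply: congr_cons.
by exists (u ++ m') => //; apply/IH/congr_refl.
Qed.

Lemma chain_inv R u m m' : chain R (inv u) m m' <-> congruence R (u ++ m) m'.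
Proof.
elim: u m' => [|s u IH] m' //=; rewrite inv_cons.
split=> [/chain_cat[k /IH Rk /= Rm']|Rm'].
  by apply: congr_trans Rm'; apply: congr_cons.
by apply/chain_cat; exists (u ++ m) => //; apply/IH/congr_refl.
Qed.

Lemma unoriented_congr R Q u v :
  (forall u v, Q (u, v) -> congruence R u v) ->
  unoriented Q (u, v) -> congruence R u v.
Proof. by move=> QR [/QR|/QR /congr_sym]. Qed.

Lemma chain_reverses R Q W W' m m' :
    (forall u v, Q (u, v) -> congruence R u v) ->
  reverses Q W W' -> chain R W' m m' -> chain R W m m'.
Proof.
move=> QR rev; elim: rev m m' => {W W'}
    [_ _ [x y u _|x y u v u' v' _ _ /(unoriented_congr QR) Ruv]|//|].
- move=> m m' /chain_cat[k cx cy]; apply/chain_cat; exists k => //.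
  apply/chain_cat; exists (u ++ k); first exact/chain_inv/congr_refl.
  by apply/chain_cat; exists k => //; apply/chain_pos/congr_refl.
(* The restored factor u^-1 v is read through u n, because u n = u v' k = v u' k = v l. *)
- move=> m m' /chain_cat[n cx /chain_cat[k /chain_pos Rn]].
  move=> /chain_cat[l /chain_inv Rl cy].
  apply/chain_cat; exists n => //; apply/chain_cat; exists (u ++ n).
    exact/chain_inv/congr_refl.
  apply/chain_cat; exists l => //; apply/chain_pos.
  apply: congr_trans (congr_catl u Rn) _; apply: congr_sym.
  apply: congr_trans (congr_catl v (congr_sym Rl)) _.
  by rewrite !catA; apply: congr_catr; apply: congr_sym.
- by move=> W1 W2 W3 _ IH1 _ IH2 m m' /IH2 /IH1.
Qed.

(** The word u v^-1 has a chain from u through the empty word to v. Pulled back to the cube, it says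
    s u = r k = t v for some k. *)
Lemma reverses_cube_congr R Q s r t u v :
    (forall u v, Q (u, v) -> congruence R u v) ->
    reverses Q (inv [:: s] ++ pos [:: r] ++ inv [:: r] ++ pos [:: t])
               (pos u ++ inv v) ->
  congruence R (s :: u) (t :: v).
Proof.
move=> QR rev; have [] := @chain_reverses R _ _ _ u v QR rev.
  apply/chain_cat; exists [::].
    by apply/chain_pos; rewrite cats0; apply: congr_refl.
  by apply/chain_inv; rewrite cats0; apply: congr_refl.
move=> k Rsu [l Rk Rl]; apply: congr_trans Rsu (congr_trans Rk _).
exact: congr_cons.
Qed.

Lemma R_completion_step_congr R Q :
    (forall u v, Q (u, v) -> congruence R u v) ->
  forall u v, R_completion_step Q (u, v) -> congruence R u v.
Proof.
move=> QR u v [/QR //|[s [r [t [u' [v' [cube _ [-> ->]]]]]]]].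
exact: reverses_cube_congr cube.
Qed.

Lemma R_completion_iter_congr R i u v :
  iter i (@R_completion_step S) R (u, v) -> congruence R u v.
Proof.
elim: i u v => [|i IH] u v; [exact: congr_rel | exact: R_completion_step_congr].
Qed.

Lemma R_completion_complete R :
    (forall u v, congruence R u v -> reverses R (inv u ++ pos v) [::]) ->
  R_completion R = R.
Proof.
move=> Rcompl; have stepR : R_completion_step R = R.
  apply/seteqP; split=> [p [//|[s [r [t [u [v [cube not_rev _]]]]]]]|p]; last by left.
  by case: not_rev; apply/Rcompl/(reverses_cube_congr _ cube)/congr_rel.
apply/seteqP; split=> [p [i _]|p Rp]; last by exists 0.
by rewrite (_ : iter i _ R = R) //; elim: i => //= i ->.
Qed.

(** * Factors of words of the form u^-1 v *)

Lemma map_inr_inl_split (x z : word (S + S)) a b (N P : word S) :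
    x ++ inr a :: inl b :: z = map inr N ++ map inl P ->
  x ++ [:: inr a] = map inr N /\ inl b :: z = map inl P.
Proof.
have no_inr x' z' P' : x' ++ inr a :: z' = map inl P' -> False.
  by elim: x' P' => [|c x' IH] [|p P'] //= [_ /IH].
elim: x N => [|c x IH] [|n N] /=; [by case: P| | by move/(no_inr _ (c :: x)) |].
  by case: N => [|n' N] //= [-> <-].
by move=> [-> /IH[-> ->]].
Qed.

Lemma map_eq_cat (T T' : Type) (f : T -> T') (u w : seq T) z : injective f ->
  map f w = map f u ++ z -> exists2 w', w = u ++ w' & z = map f w'.
Proof.
move=> f_inj; elim: u w => [|a u IH] w; first by exists w.
by case: w => //= b w [/f_inj-> /IH[w' -> ->]]; exists w'.
Qed.

(** The sign changes only once in X^-1 Y, so a factor u^-1 v must straddle that place. This confines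
    the first reversing step to prefixes of X and Y. *)
Lemma inv_pos_split x y u v X Y : u <> [::] -> v <> [::] ->
    x ++ inv u ++ pos v ++ y = inv X ++ pos Y ->
  exists X' Y', [/\ X = u ++ X', Y = v ++ Y', x = inv X' & y = pos Y'].
Proof.
case: u => [//|a u] _; case: v => [//|b v] _ E.
have [] := @map_inr_inl_split (x ++ inv u) (pos v ++ y) a b (rev X) Y.
  by rewrite -[RHS]E inv_cons -!catA.
rewrite -catA -inv_cons => Ex /esym Ey.
have [] := @map_eq_cat _ _ _ (b :: v) Y y _ Ey; first by move=> ? ? [].
move=> Y' -> ->.
have [] := @map_eq_cat _ _ (@inr S S) (a :: u) X (rev x); first by move=> ? ? [].
  by rewrite -[X in map _ X]revK map_rev -Ex rev_cat /inv map_rev revK.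
move=> X' -> Ex'; exists X', Y'; split=> //.
by rewrite -[x]revK Ex' /inv map_rev.
Qed.

End Reversing.
Lemma infinite_set_unbounded T (A : set T) (f : T -> nat) :
  (forall n, exists2 p, A p & f p = n) -> infinite_set A.
Proof.
move=> fA /(finite_image f); rewrite (_ : f @` A = setT); first exact: infinite_nat.
by apply/seteqP; split=> // n _; have [p Ap <-] := fA n; exists p.
Qed.

(** * Types 1 and 3 *)

Section LastLetter.
Local Notation a := true.
Local Notation b := false.
Local Notation lt := (deglex 2 nat_of_bool).

Definition R_last : relations bool := [set` [:: ([:: a; a], [:: b; a])]].

Definition R_last_redundant : relations bool :=
  [set` [:: ([:: a; a], [:: b; a]); ([:: a; a; a], [:: b; a; a])]].

Definition G_last : relations bool :=
  [set p | exists n, p = (a :: nseq n b ++ [:: a], b :: nseq n b ++ [:: a])].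

(* A word of the monoid is determined by its length and the position of its
   last a; the normal form has b everywhere before that position. *)
Definition last_act (s : bool) (w : word bool) :=
  if s && (a \in w) then b :: w else s :: w.

Lemma bool_deglex_admissible : admissible_ordering lt.
Proof. by apply: deglex_admissible => // [[]|[] []]. Qed.

Lemma behead_last_act s w : behead (last_act s w) = w.
Proof. by rewrite /last_act; case: ifP. Qed.

Lemma mem_last_act s w : (a \in last_act s w) = (a \in s :: w).
Proof. by rewrite /last_act; case: s => //=; case: ifP => //; rewrite inE => ->. Qed.

Lemma mem_foldr_last_act w : (a \in foldr last_act [::] w) = (a \in w).
Proof. by elim: w => //= s w IH; rewrite mem_last_act !inE IH. Qed.

(** Once the second letter has acted, an a is present, so an a put in front is written as b. *)
Lemma last_act_rel w z :
  foldr last_act z [:: a, a & w] = foldr last_act z [:: b, a & w].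
Proof. by rewrite /= {1}/last_act mem_last_act inE. Qed.

Lemma first_a w : a \in w -> exists n w', w = nseq n b ++ a :: w'.
Proof.
elim: w => [//|[] w IH]; first by exists 0, w.
by move=> /IH[n [w' ->]]; exists n.+1, w'.
Qed.

(** * Both completions, for any presentation containing aa = ba and respecting this normal form *)

Section Presentation.
Variable R : relations bool.
Hypothesis Raa : R ([:: a; a], [:: b; a]).
Hypothesis Ract : forall u v z, R (u, v) -> foldr last_act z u = foldr last_act z v.

(** When w starts with b, write w = b w1: then a b w1 = a a w1 = b a w1 = b b w1, where the outer
    equalities come from induction. *)
Lemma congr_ab w : a \in w -> congruence R (a :: w) (b :: w).
Proof.
have Raaw x : congruence R [:: a, a & x] [:: b, a & x].
  exact: (congr_catr x (congr_rel Raa)).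
elim: w => [//|[] w IH] //= /IH Rw.
apply: congr_trans (congr_cons a (congr_sym Rw)) _.
exact: congr_trans (Raaw w) (congr_cons b Rw).
Qed.

Lemma last_groebner : is_G_completion lt R G_last.
Proof.
have [_ _ _ _ ctx] := bool_deglex_admissible.
have lt_ab w : lt (b :: w) (a :: w) by exact: (ctx [:: b] [:: a] [::] w).
split.
  apply: (groebner_of_action bool_deglex_admissible _ Ract).
    move=> u v [n [-> ->]]; split; last exact: lt_ab.
    by apply: congr_ab; rewrite mem_cat inE orbT.
  move=> [] w; last by left.
  rewrite /last_act /=; case: ifP => [/first_a[n [w' ->]]|_]; last by left.
  right; split; first exact: lt_ab.
  exists (a :: nseq n b ++ [:: a]), (b :: nseq n b ++ [:: a]); split; first by exists n.
  by apply/prefixP; exists w'; rewrite /= -catA.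
(* A left-hand side has two letters a and a right-hand side only one. A factor a b^m a of a b^n a
   uses both of its letters a, so m = n. *)
move=> u v u' v' [n [-> ->]] [m [-> ->]]; split.
  apply/negP => /infixW /(leq_count_subseq (pred1 a)).
  by rewrite /= !count_cat !count_nseq.
move=> neq; apply/negP => /infixP[[|s x] [y]] [].
  have idx k w : index a (nseq k b ++ a :: w) = k by elim: k => //= k ->.
  rewrite -catA => /(congr1 (index a)); rewrite !idx => E.
  by rewrite E in neq.
by move=> _ /(congr1 (count_mem a)); rewrite !count_cat /= !count_cat !count_nseq /=; lia.
Qed.

(** Both b^-1 a and a^-1 b reverse to a a^-1, so a passes over each b until it cancels against the
    first a of X. This exhibits X as a X0. *)
Lemma reverses_a X : a \in X -> exists X0,
  [/\ size X = (size X0).+1,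
      reverses R (inv X ++ pos [:: a]) (inv X0),
      reverses R (inv [:: a] ++ pos X) (pos X0)
    & foldr last_act [::] (a :: X0) = foldr last_act [::] X].
Proof.
elim: X => [//|[] X IH].
  exists X; split=> //; last exact: (@reverses_delete_head _ R a [::] X).
  by have := @reverses_delete_head _ R a X [::]; rewrite cats0.
move=> /IH[X0 [Esz revX revX' nfX]]; exists (a :: X0); split.
- by rewrite /= Esz.
- rewrite (inv_cons a); apply: rt_trans _ (reverses_ctx [::] (inv [:: a]) revX).
  have := @reverses_replace_head _ R b a [:: a] [:: a] X [::].
  by rewrite cats0 catA; apply; right.
- apply: rt_trans _ (_ : reverses R (pos [:: a] ++ inv [:: a] ++ pos X) _); last first.
    by have := reverses_ctx (pos [:: a]) [::] revX'; rewrite !cats0.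
  have := @reverses_replace_head _ R a b [:: a] [:: a] [::] X.
  by apply; left.
- by rewrite last_act_rel [RHS]/= -nfX.
Qed.

Lemma last_reversing_complete u v :
  congruence R u v -> reverses R (inv u ++ pos v) [::].
Proof.
move=> /(congruence_foldr Ract) /(_ [::]).
have [n] := ubnP (size u); elim: n u v => // n IH [|s u] [|t v].
- by move=> _ _; apply: rt_refl.
- by move=> _ /(congr1 size); rewrite /= /last_act; case: ifP.
- by move=> _ /(congr1 size); rewrite /= /last_act; case: ifP.
(* [behead] undoes the action of any letter, so s u = t v yields u = v even when s and t differ. *)
rewrite ltnS => lt_u E; have Euv : foldr last_act [::] u = foldr last_act [::] v.
  by have := congr1 behead E; rewrite /= !behead_last_act.
have [Est|neq_st] := eqVneq s t.
  by rewrite Est; apply: rt_trans (reverses_delete_head _ _ _ _) (IH _ _ lt_u Euv).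
(* Distinct letters act alike only on words containing a. *)
have a_u : a \in u.
  move: E; rewrite /= /last_act Euv mem_foldr_last_act -(mem_foldr_last_act u) Euv.
  rewrite mem_foldr_last_act.
  by case: s t neq_st {lt_u} => [] [] //= _; case: (a \in v).
have a_v : a \in v by rewrite -mem_foldr_last_act -Euv mem_foldr_last_act.
(* The reversing is u^-1 s^-1 t v -> u^-1 a a^-1 v -> u0^-1 v0, and a u0 = u = v = a v0 gives u0 =
   v0. *)
have [u0 [size_u rev_u _ nf_u]] := reverses_a a_u.
have [v0 [_ _ rev_v nf_v]] := reverses_a a_v.
have rev0 : reverses R (inv u0 ++ pos v0) [::].
  apply: IH; first by move: lt_u; rewrite /= size_u; lia.
  by have := congr1 behead (etrans nf_u (etrans Euv (esym nf_v))); rewrite /= !behead_last_act.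
apply: rt_trans (reverses_replace_head (p := [:: a]) (q := [:: a]) _ _ _) _.
  by case: s t neq_st {E lt_u} => [] [] // _; [left | right].
apply: rt_trans rev0; rewrite catA.
apply: rt_trans (reverses_ctx [::] _ rev_u) _.
by have := reverses_ctx (inv u0) [::] rev_v; rewrite !cats0.
Qed.

End Presentation.

Lemma R_last_act u v z : R_last (u, v) -> foldr last_act z u = foldr last_act z v.
Proof. by rewrite /R_last /= inE => /eqP[-> ->]; apply: last_act_rel. Qed.

Lemma R_last_redundant_act u v z :
  R_last_redundant (u, v) -> foldr last_act z u = foldr last_act z v.
Proof.
by rewrite /R_last_redundant /= !inE => /orP[] /eqP[-> ->]; apply: last_act_rel.
Qed.

Lemma type1_example :
  [/\ finite_presentation_with_G_completion lt R_last G_last,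
      unoriented (R_completion R_last) `<` unoriented G_last,
      finite_set (R_completion R_last) & infinite_set G_last].
Proof.
have Raa : R_last ([:: a; a], [:: b; a]) by rewrite /R_last /= inE.
rewrite (R_completion_complete (last_reversing_complete Raa R_last_act)).
split; first split.
- by split; [exact: (inhabits a) | move=> u v; rewrite /R_last /= inE => /eqP[-> ->]].
- exact: finite_seq.
- exact: bool_deglex_admissible.
- exact: last_groebner Raa R_last_act.
- split=> [[u v]|]; rewrite /unoriented /R_last /=.
    by rewrite !inE => -[] /eqP[-> ->]; [left | right]; exists 0.
  move=> /(_ ([:: a; b; a], [:: b; b; a])); rewrite /= !inE.
  by case=> //; left; exists 1.
- exact: finite_seq.
- apply: (@infinite_set_unbounded _ _ (fun p => (size p.1).-2)) => n.
  eexists; first by exists n.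
  by rewrite /= size_cat size_nseq addn1.
Qed.

Lemma type3_example :
  [/\ finite_presentation_with_G_completion lt R_last_redundant G_last,
      ~ unoriented G_last `<=` unoriented (R_completion R_last_redundant)
    & ~ unoriented (R_completion R_last_redundant) `<=` unoriented G_last].
Proof.
have Raa : R_last_redundant ([:: a; a], [:: b; a]) by rewrite /R_last_redundant /= inE.
rewrite (R_completion_complete (last_reversing_complete Raa R_last_redundant_act)).
split; first split.
- split; [exact: (inhabits a) | move=> u v; rewrite /R_last_redundant /= !inE].
  by case/orP => /eqP[-> ->].
- exact: finite_seq.
- exact: bool_deglex_admissible.
- exact: last_groebner Raa R_last_redundant_act.
- move=> /(_ ([:: a; b; a], [:: b; b; a])).
  case; first by left; exists 1.
    by [].
  by [].
- move=> /(_ ([:: a; a; a], [:: b; a; a])).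
  by case; [left | case=> -[|[]] | case=> -[|[]]].
Qed.

End LastLetter.
(** * Type 1' *)

Section Square.
Local Notation a := false.
Local Notation b := true.
Local Notation lt := (deglex 2 nat_of_bool).

Definition R_square : relations bool := [set` [:: ([:: a; a], [:: b])]].

Definition G_square : relations bool :=
  [set` [:: ([:: a; a], [:: b]); ([:: b; a], [:: a; b])]].

(** Normal forms are b^n and a b^n, so a single rewriting at the front renormalizes. *)
Definition square_act (s : bool) (w : word bool) :=
  match s, w with
  | a, a :: w => b :: w
  | b, a :: w => [:: a, b & w]
  | s, w => s :: w
  end.

(* The monoid is free on a, with b = a^2, so the weight is its only invariant. *)
Definition weight (w : word bool) := sumn [seq (nat_of_bool s).+1 | s <- w].

Lemma square_weight u v : congruence R_square u v -> weight u = weight v.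
Proof.
elim=> {u v} //.
- by move=> u v; rewrite /R_square /= inE => /eqP[-> ->].
- by move=> u v w _ -> _ ->.
- by move=> x y u v _; rewrite /weight !map_cat !sumn_cat => ->.
Qed.

(** Induction on the weight: equal first letters cancel, while b^-1 a becomes a^-1 and a^-1 b
    becomes a, which lowers both weights by 1. *)
Lemma square_reversing_complete u v :
  congruence R_square u v -> reverses R_square (inv u ++ pos v) [::].
Proof.
move=> /square_weight.
have [n] := ubnP (weight u); elim: n u v => // n IH [|s u] [|t v] //.
  by move=> _ _; apply: rt_refl.
have Rab : R_square ([:: a; a], [:: b]) by rewrite /R_square /= inE.
rewrite /weight /= -!/(weight _) => lt_u Euv.
have [Est|neq_st] := eqVneq s t.
  subst t; apply: rt_trans (reverses_delete_head _ _ _ _) _.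
  by apply: IH; lia.
case: s t neq_st lt_u Euv => [] [] //= _ lt_u Euv.
  apply: rt_trans (reverses_replace_head (p := [::]) (q := [:: a]) _ _ _) _.
    by right.
  have := IH (a :: u) v; rewrite inv_cons -catA; apply;
    rewrite /weight /= -!/(weight _); lia.
apply: rt_trans (reverses_replace_head (p := [:: a]) (q := [::]) _ _ _) _.
  by left.
apply: (IH u (a :: v)); rewrite /weight /= -!/(weight _); lia.
Qed.

Lemma square_groebner : is_G_completion lt R_square G_square.
Proof.
have [_ _ _ _ ctx] := bool_deglex_admissible.
have Rab : congruence R_square [:: a; a] [:: b].
  by apply: congr_rel; rewrite /R_square /= inE.
have Gaa : G_square ([:: a; a], [:: b]) by rewrite /G_square /= inE.
have Gba : G_square ([:: b; a], [:: a; b]) by rewrite /G_square /= !inE.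
split.
  apply: (groebner_of_action (act := square_act) bool_deglex_admissible).
  - move=> u v; rewrite /G_square /= !inE => /orP[] /eqP[-> ->]; split=> //.
    (* Here ba = aaa = ab. *)
    apply: congr_trans (congr_catr [:: a] (congr_sym Rab)) _.
    exact: congr_cons.
  - by move=> u v z; rewrite /R_square /= inE => /eqP[-> ->]; case: z => [|[] [|[] z]].
  - move=> [] [|[] w]; try (by left); right; split.
    + exact: (ctx [:: a; b] [:: b; a] [::] w).
    + by exists [:: b; a], [:: a; b]; rewrite /= prefix0s.
    + exact: (ctx [:: b] [:: a; a] [::] w).
    + by exists [:: a; a], [:: b]; rewrite /= prefix0s.
by move=> u v u' v'; rewrite /G_square /= !inE => /orP[] /eqP[-> ->] /orP[] /eqP[-> ->].
Qed.

Lemma type1'_example :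
  [/\ finite_presentation_with_G_completion lt R_square G_square,
      unoriented (R_completion R_square) `<` unoriented G_square,
      finite_set (R_completion R_square) & finite_set G_square].
Proof.
rewrite (R_completion_complete square_reversing_complete).
split; [split | split | exact: finite_seq | exact: finite_seq].
- by split; [exact: (inhabits a) | move=> u v; rewrite /R_square /= inE => /eqP[-> ->]].
- exact: finite_seq.
- exact: bool_deglex_admissible.
- exact: square_groebner.
- by move=> [u v]; rewrite /unoriented /R_square /G_square /= !inE => -[] ->; [left | right].
- move=> /(_ ([:: b; a], [:: a; b])); rewrite /unoriented /R_square /G_square /= !inE.
  by case=> //; left.
Qed.

End Square.

(** * Type 2 *)

Section Commutation.
Local Notation L := (bool * bool)%type.
Local Notation c := (false, false).
Local Notation a := (false, true).
Local Notation b := (true, false).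
Local Notation d := (true, true).
(* c < a < b < d *)
Definition comm_digit (s : bool * bool) : nat := s.1 * 2 + s.2.

Local Notation lt := (deglex 4 comm_digit).

Definition R_comm : relations L :=
  [set` [:: ([:: a; c], [:: c; a]); ([:: b; c], [:: c; b]); ([:: b; d], [:: a; d])]].

Fixpoint insert_a (w : word L) :=
  if w is c :: w then c :: insert_a w else a :: w.

Fixpoint insert_b (w : word L) :=
  match w with
  | c :: w => c :: insert_b w
  | d :: w => [:: a, d & w]
  | w => b :: w
  end.

Definition comm_act (s : L) (w : word L) :=
  match s with a => insert_a w | b => insert_b w | s => s :: w end.

Lemma comm_deglex_admissible : admissible_ordering lt.
Proof. by apply: deglex_admissible => // [[[] []]|[[] []] [[] []]]. Qed.

Lemma comm_groebner : is_G_completion lt R_comm R_comm.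
Proof.
have [_ tr _ _ ctx] := comm_deglex_admissible.
have [Rac Rbc Rbd] : [/\ R_comm ([:: a; c], [:: c; a]), R_comm ([:: b; c], [:: c; b])
    & R_comm ([:: b; d], [:: a; d])] by rewrite /R_comm /= !inE.
split.
  apply: (groebner_of_action (act := comm_act) comm_deglex_admissible).
  - move=> u v Ruv; split; first exact: congr_rel.
    by move: Ruv; rewrite /R_comm /= !inE => /or3P[] /eqP[-> ->].
  - by move=> u v z; rewrite /R_comm /= !inE => /or3P[] /eqP[-> ->].
  - have lt_act s w : comm_act s w = s :: w \/ lt (comm_act s w) (s :: w).
      case: s => -[] []; try (by left); elim: w => [|[[] []] w IH]; try (by left).
      + by right; apply: (ctx [:: a; d] [:: b; d] [::] w).
      + right; case: IH => /= [->|/(ctx _ _ [:: c] [::])].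
          exact: (ctx [:: c; b] [:: b; c] [::] w).
        by rewrite !cats0 => /tr; apply; apply: (ctx [:: c; b] [:: b; c] [::] w).
      + right; case: IH => /= [->|/(ctx _ _ [:: c] [::])].
          exact: (ctx [:: c; a] [:: a; c] [::] w).
        by rewrite !cats0 => /tr; apply; apply: (ctx [:: c; a] [:: a; c] [::] w).
    (* If the action fixes s w, then [lt_s] is absurd; otherwise the first two letters of s w form a
       left-hand side. *)
    move=> s w; case: (lt_act s w) => [|lt_s]; [by left | right; split=> //].
    case: s lt_s => -[] [] /=; rewrite ?/lt ?ltnn //.
    + by case: w => [|[[] []] w] /=; rewrite /deglex ?ltnn // => _;
        [exists [:: b; d], [:: a; d] | exists [:: b; c], [:: c; b]];
        rewrite /= prefix0s.
    + by case: w => [|[[] []] w] /=; rewrite /deglex ?ltnn // => _;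
        exists [:: a; c], [:: c; a]; rewrite /= prefix0s.
by move=> u v u' v'; rewrite /R_comm /= !inE => /or3P[] /eqP[-> ->] /or3P[] /eqP[-> ->].
Qed.

(** No relation exchanges c with d, so the number of c's before the first d is invariant; it
    separates the common multiples a c^n d. *)
Definition c_before_d_act (s : L) (n : option nat) :=
  match s with d => Some 0 | c => omap succn n | _ => n end.

Definition c_before_d : word L -> option nat := foldr c_before_d_act None.

Lemma c_before_d_congr u v : congruence R_comm u v -> c_before_d u = c_before_d v.
Proof.
move=> Ruv; apply: congruence_foldr Ruv _ => {}u {}v z.
by rewrite /R_comm /= !inE => /or3P[] /eqP[-> ->].
Qed.

Lemma c_before_d_cat u v n : c_before_d u = Some n -> c_before_d (u ++ v) = Some n.
Proof.
elim: u n => [|s u IH] n //=; rewrite -!/(c_before_d _).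
by case: s => -[] [] //=; first [exact: IH | case: (c_before_d u) IH => //= m /(_ _ erefl) ->].
Qed.

(* Yields [None] if d occurs, and otherwise the first letter other than c; this
   is invariant because only b d = a d can change that letter. *)
Definition first_letter_act (s : L) (x : option L) :=
  match s with
  | d => None
  | c => x
  | s => omap (fun=> s) x
  end.

Lemma congr_a_b_has_d x y : congruence R_comm (a :: x) (b :: y) ->
  (* The start value [Some c] stands for words without any letter other than c. If d did not occur
     in a x, its value would be [Some a], which no word b y has. *)
  exists n, c_before_d (a :: x) = Some n.
Proof.
move=> Rxy; have /= : foldr first_letter_act (Some c) (a :: x)
    = foldr first_letter_act (Some c) (b :: y).
  apply: congruence_foldr Rxy _ => u v z.
  rewrite /R_comm /= !inE => /or3P[] /eqP[-> ->] //=; case: z => //.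
have no_d : foldr first_letter_act (Some c) x = None -> exists n, c_before_d x = Some n.
  elim: x {Rxy} => [//|[[] []] x IH] /=; rewrite -/(c_before_d _).
  - by exists 0.
  - by case: foldr IH => // IH _; apply: IH.
  - by case: foldr IH => // IH _; apply: IH.
  - by move=> /IH[n ->]; exists n.+1.
case: (foldr first_letter_act _ x) no_d => [s _|no_d _]; last exact: no_d.
by case: (foldr first_letter_act _ y).
Qed.

Definition ab_relation (Q : relations L) n :=
  exists x y, unoriented Q (a :: x, b :: y) /\ c_before_d (a :: x) = Some n.

(* A relation of Q with the same parameter n has to be used in the first step,
   the only one where a^-1 meets b. *)
Lemma reverses_ab_relation (Q : relations L) x y n :
    (forall u v, Q (u, v) -> congruence R_comm u v) ->
    c_before_d (a :: x) = Some n ->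
  reverses Q (inv (a :: x) ++ pos (b :: y)) [::] -> ab_relation Q n.
Proof.
move=> QR Ex /clos_rt_rt1n_iff rev.
move EW: (_ ++ _) rev => W; move EZ: [::] => Z rev.
case: rev EZ => [EZ|W1 {}Z step /clos_rt_rt1n_iff rev EZ].
  by move: EW; rewrite -EZ => /(congr1 size); rewrite size_cat [size (pos _)]size_map addnS.
subst Z; case: step EW rev => [x' y' u un0|x' y' u v u' v' un0 vn0 Quv] /esym.
  move=> /(inv_pos_split un0 un0)[X' [Y' [EX EY _ _]]] _.
  by case: u un0 EX EY => // s u _ [<- _] [].
move=> /(inv_pos_split un0 vn0)[X' [Y' [EX EY -> ->]]].
(* A chain from the empty word to itself gives X' = v' l, hence a x = u X' = u v' l in the monoid.
   Since u starts with a and v with b, the relation u v' = v u' forces a d in u v', which therefore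
   already determines n. *)
move=> /(chain_reverses QR) /(_ (congr_refl _ [::])).
case: u un0 EX Quv => // _ u _ [<- EX] Quv; case: v vn0 EY Quv => // _ v _ [<- EY] Quv.
move=> /chain_cat[k /chain_inv + /chain_cat[l /chain_pos Rk _]].
rewrite cats0 => RX'.
have [m Em] := congr_a_b_has_d (unoriented_congr QR Quv).
exists (u ++ v'), (v ++ u'); split=> //; rewrite -Ex EX.
apply/esym/(etrans (c_before_d_congr (congr_catl (a :: u) (congr_trans RX' Rk)))).
by rewrite catA (c_before_d_cat _ Em) -Em.
Qed.

Lemma R_completion_ab_relation n :
  exists i, ab_relation (iter i (@R_completion_step L) R_comm) n.
Proof.
elim: n => [|n [i [x [y [Qxy Ex]]]]].
  by exists 0, [:: d], [:: d]; split=> //; right; rewrite /R_comm /= !inE.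
set Q := iter i _ _ in Qxy.
have QR u v : Q (u, v) -> congruence R_comm u v by exact: R_completion_iter_congr.
have R_Q u v : R_comm (u, v) -> Q (u, v).
  by rewrite /Q; elim: (i) => //= j IH /IH; left.
have Ecx : c_before_d [:: a, c & x] = Some n.+1.
  by rewrite /= -/(c_before_d _); move: Ex => /= ->.
(* If a c x = b c y is already derivable by reversing, some relation with parameter n+1 is present;
   otherwise the next stage adds this one. *)
have [rev|not_rev] := pselect (reverses Q (inv [:: a, c & x] ++ pos [:: b, c & y]) [::]).
  by exists i; apply: reverses_ab_relation Ecx rev.
exists i.+1, (c :: x), (c :: y); split=> //; left; right.
exists a, c, b, (c :: x), (c :: y); split=> //.
(* The cube reverses as a^-1 c c^-1 b -> c a^-1 c^-1 b -> c a^-1 b c^-1 -> c x y^-1 c^-1. *)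
apply: rt_trans (_ : reverses Q _ ((pos [:: c] ++ inv [:: a]) ++ pos [:: b] ++ inv [:: c])) _.
  apply: rt_trans (_ : reverses Q _ ((pos [:: c] ++ inv [:: a]) ++ inv [:: c] ++ pos [:: b])) _.
    have := reverses_ctx [::] (inv [:: c] ++ pos [:: b])
      (@reverses_replace_head _ Q a c [:: c] [:: a] [::] [::] _).
    by apply; left; apply: R_Q; rewrite /R_comm /= !inE.
  have := reverses_ctx (pos [:: c] ++ inv [:: a]) [::]
    (@reverses_replace_head _ Q c b [:: b] [:: c] [::] [::] _).
  rewrite !cats0; apply; right; apply: R_Q; by rewrite /R_comm /= !inE.
rewrite -catA (inv_cons c y).
have := reverses_ctx (pos [:: c]) (inv [:: c])
    (@reverses_replace_head _ Q a b x y [::] [::] Qxy).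
by rewrite -!catA; apply.
Qed.

Lemma type2_example :
  [/\ finite_presentation_with_G_completion lt R_comm R_comm,
      unoriented R_comm `<` unoriented (R_completion R_comm),
      finite_set R_comm & infinite_set (R_completion R_comm)].
Proof.
have R_sub : R_comm `<=` R_completion R_comm by move=> p Rp; exists 0.
have ab_unoriented n : exists x y, unoriented (R_completion R_comm) (a :: x, b :: y)
    /\ c_before_d (a :: x) = Some n.
  have [i [x [y [Qxy Ex]]]] := R_completion_ab_relation n.
  by exists x, y; split=> //; case: Qxy => Qxy; [left | right]; exists i.
split; [split | split | exact: finite_seq |].
- by split; [exact: (inhabits a) |
    move=> u v; rewrite /R_comm /= !inE => /or3P[] /eqP[-> ->]].
- exact: finite_seq.
- exact: comm_deglex_admissible.
- exact: comm_groebner.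
- by move=> p [Rp|Rp]; [left | right]; apply: R_sub.
- move=> sub; have [x [y [Qxy Ex]]] := ab_unoriented 1.
  by case: (sub _ Qxy); rewrite /R_comm /= !inE => /or3P[] // /eqP[Ey Ex0]; move: Ex; rewrite Ex0.
(* The default 0 is harmless, as each n is attained on a word containing d. For a relation oriented
   from b y to a x, invariance carries the count over. *)
- apply: (@infinite_set_unbounded _ _ (fun p => odflt 0 (c_before_d p.1))) => n.
  have [x [y [[Qxy|Qxy] Ex]]] := ab_unoriented n.
    by exists (a :: x, b :: y) => //; apply: congr1 Ex.
  exists (b :: y, a :: x) => //; have [i _ Qi] := Qxy; apply: (congr1 _ (y := Some n)).
  exact: etrans (c_before_d_congr (R_completion_iter_congr Qi)) Ex.
Qed.

End Commutation.

(** * The examples collected *)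

Theorem proposition3p1 :
  (* the two completions need not agree *)
  (exists (S : finType) (lt : rel (word S)) (R G : relations S),
     finite_presentation_with_G_completion lt R G /\
     unoriented G <> unoriented (R_completion R)) /\
  (* type 1 *)
  (exists (S : finType) (lt : rel (word S)) (R G : relations S),
     finite_presentation_with_G_completion lt R G /\
     [/\ unoriented (R_completion R) `<` unoriented G,
         finite_set (R_completion R) & infinite_set G]) /\
  (* type 1' *)
  (exists (S : finType) (lt : rel (word S)) (R G : relations S),
     finite_presentation_with_G_completion lt R G /\
     [/\ unoriented (R_completion R) `<` unoriented G,
         finite_set (R_completion R) & finite_set G]) /\
  (* type 2 *)
  (exists (S : finType) (lt : rel (word S)) (R G : relations S),
     finite_presentation_with_G_completion lt R G /\
     [/\ unoriented G `<` unoriented (R_completion R),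
         finite_set G & infinite_set (R_completion R)]) /\
  (* type 3 *)
  (exists (S : finType) (lt : rel (word S)) (R G : relations S),
     finite_presentation_with_G_completion lt R G /\
     ~ unoriented G `<=` unoriented (R_completion R) /\
     ~ unoriented (R_completion R) `<=` unoriented G).
Proof.
have [pres1 proper1 fin1 inf1] := type1_example.
have [pres1' proper1' fin1' finG1'] := type1'_example.
have [pres2 proper2 fin2 inf2] := type2_example.
have [pres3 nsub nsub'] := type3_example.
split.
  exists bool, (deglex 2 nat_of_bool), R_last, G_last; split=> // E.
  by case: proper1 => _; apply; rewrite E.
split; first by exists bool, (deglex 2 nat_of_bool), R_last, G_last.
split; first by exists bool, (deglex 2 nat_of_bool), R_square, G_square.
split; last by exists bool, (deglex 2 nat_of_bool), R_last_redundant, G_last.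
by exists (bool * bool)%type, (deglex 4 comm_digit), R_comm, R_comm.
Qed.
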